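(* Let $p$ be a prime and let $G$ be a finite nonabelian $p$-group that is an NS--group. Then $|G| \geq p^{p+6}$. Moreover, if $|G| = p^{p+6}$, then: (a) $d(G) = 2$; (b) $|Z(\Phi(G))| = p^{p+2}$; (c) $Z(G)$ is cyclic of order $p$; (d) if $p=2$, then $Z(\Phi(G))$ is isomorphic to $(\mathbb{Z}/2)^4$ or to $\mathbb{Z}/4 \times (\mathbb{Z}/2)^2$.
   Context: For a finite $p$-group $G$: $\Phi(G)$ is the Frattini subgroup, $Z(H)$ is the center of a group $H$, and $d(G)$ is the minimum number of generators of $G$. The Frattini quotient $Q = G/\Phi(G)$ acts by conjugation on $A = Z(\Phi(G))$. For a finite group $Q$ and a $\mathbb{Z}Q$-module $A$, $\hat{H}^n(Q;A)$ denotes Tate cohomology; in particular $\hat{H}^0(Q;A)$ is $A^Q$ modulo the image of the trace map $a \mapsto \sum_{q\in Q} qa$. A finite nonabelian $p$-group $G$ is called an S--group if $\hat{H}^0(G/\Phi(G); Z(\Phi(G))) \neq 0$, and an NS--group if $\hat{H}^0(G/\Phi(G); Z(\Phi(G))) = 0$. *)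

(* Defs.v *)
From mathcomp Require Import all_boot all_fingroup all_solvable all_algebra.

Set Implicit Arguments.
Unset Strict Implicit.
Unset Printing Implicit Defensive.

Import FiniteModule.

Local Open Scope group_scope.

(* Q-modules are written multiplicatively: a finite ZQ-module is a finite    *)
(* abelian group A on which Q acts by group automorphisms.                   *)
Section TateH0.

Variables (aT rT : finGroupType) (D : {group aT}) (R : {group rT}).
Variable to : groupAction D R.

Definition tate_trace (Q : {group aT}) (a : rT) : rT :=
  \prod_(q in Q) to a q.

(* For a Q-module A the trace image is already a subgroup of A^Q, by         *)
(* tate_trace_group_set and tate_trace_sub; the generated-group brackets     *)
(* only supply the group structure expected of a denominator.                *)
Definition tateH0 (Q : {group aT}) (A : {group rT}) :=
  'C_(A | to)(Q) / <<tate_trace Q @: A>>.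

Lemma tate_trace_group_set (Q : {group aT}) (A : {group rT}) :
  abelian A -> {acts Q, on group A | to} -> group_set (tate_trace Q @: A).
Proof.
move=> abA [actQ sAR].
have sQD : Q \subset D.
  by apply: subset_trans actQ _; apply/subsetP=> q; apply: astabs_dom.
have toA a q : a \in A -> q \in Q -> to a q \in A.
  by move=> Aa Qq; rewrite (acts_act actQ).
apply/group_setP; split.
  apply/imsetP; exists 1 => //.
  by rewrite /tate_trace big1 // => q Qq; rewrite gact1 // (subsetP sQD).
move=> _ _ /imsetP[a Aa ->] /imsetP[b Ab ->].
apply/imsetP; exists (a * b); first by rewrite groupM.
suff [] : [/\ tate_trace Q a * tate_trace Q b = tate_trace Q (a * b),
              tate_trace Q a \in A & tate_trace Q b \in A] by [].
rewrite /tate_trace.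
apply: (big_rec3 (fun x y z => [/\ x * y = z, x \in A & y \in A])).
  by rewrite mulg1 group1.
move=> q z y x Qq [<- Ax Ay]; rewrite !groupM ?toA //; split=> //.
rewrite gactM ?(subsetP sQD) ?(subsetP sAR) // !mulgA.
congr (_ * _); rewrite -!mulgA; congr (_ * _).
by apply: (centsP abA); rewrite ?toA.
Qed.

Lemma tate_trace_sub (Q : {group aT}) (A : {group rT}) :
  abelian A -> {acts Q, on group A | to} ->
  tate_trace Q @: A \subset 'C_(A | to)(Q).
Proof.
move=> abA actQA; have [actQ sAR] := actQA.
have sQD : Q \subset D.
  by apply: subset_trans actQ _; apply/subsetP=> q; apply: astabs_dom.
have toA a q : a \in A -> q \in Q -> to a q \in A.
  by move=> Aa Qq; rewrite (acts_act actQ).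
have prodE (F : aT -> rT) : {in Q, forall q, F q \in A} ->
    \prod_(q in Q) F q = fmval (\sum_(q in Q) fmod abA (F q))%R.
  by move=> FA; rewrite fmval_sum; apply: eq_bigr => q /FA Aq; rewrite [RHS]fmodK.
apply/subsetP=> _ /imsetP[a Aa ->].
have aQ : {in Q, forall q, to a q \in A} by move=> q; apply: toA.
have At : tate_trace Q a \in A by rewrite /tate_trace prodE // fmodP.
rewrite inE At gacentE //= inE (subsetP sAR) //=.
apply/afixP=> s Qs.
have [-> _] : to (tate_trace Q a) s = \prod_(q in Q) to a (q * s)
              /\ tate_trace Q a \in A.
  rewrite /tate_trace; apply: (big_rec2 (fun x y => to x s = y /\ x \in A)).
    by rewrite gact1 ?(subsetP sQD).
  move=> q y x Qq [<- Ax]; rewrite groupM ?toA // actMin ?(subsetP sQD) //.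
  by rewrite gactM ?(subsetP sQD) ?(subsetP sAR) ?toA.
rewrite /tate_trace !prodE //; last by move=> q Qq; rewrite toA ?groupM.
congr fmval; rewrite [RHS](reindex_inj (mulIg s)) /=.
by apply: eq_bigl => q; rewrite groupMr.
Qed.

End TateH0.

(* 'J %% 'Phi(G) is the conjugation action of cosets of 'Phi(G) on the       *)
(* elements centralised by 'Phi(G).                                          *)
Definition NS_group (gT : finGroupType) (p : nat) (G : {group gT}) : Prop :=
  [/\ p.-group G, ~~ abelian G
    & tateH0 ('J %% 'Phi(G)) (G / 'Phi(G)) 'Z('Phi(G)) = 1].

Lemma frattini_center_module (gT : finGroupType) (G : {group gT}) :
  {acts G / 'Phi(G), on group 'Z('Phi(G)) | 'J %% 'Phi(G)}
  /\ {in 'Z('Phi(G)) & G, forall a g,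
       ('J %% 'Phi(G))%act a (coset 'Phi(G) g) = a ^ g}.
Proof.
have nPG := normal_norm (Phi_normal G).
have sZC : 'Z('Phi(G)) \subset 'C('Phi(G)) by apply: subsetIr.
have nZG : G \subset 'N('Z('Phi(G))).
  exact: char_norm_trans (center_char _) nPG.
have actE : {in 'Z('Phi(G)) & G, forall a g,
     ('J %% 'Phi(G))%act a (coset 'Phi(G) g) = a ^ g}.
  move=> a g Za Gg; rewrite /= modactE ?(subsetP nPG) ?in_setT //.
  apply/afixP=> x /setIP[_ Px]; apply/conjg_fixP/commgP.
  exact: (centP (subsetP sZC a Za)).
split=> //; split.
  apply/subsetP=> _ /morphimP[g Ng Gg ->].
  rewrite inE mem_quotient ?inE //=; apply/subsetP=> a Za.
  by rewrite inE /= actE // memJ_norm // (subsetP nZG).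
by rewrite gacentJ.
Qed.

(* Main.v *)
Require Import Defs.
From HB Require Import structures.
From mathcomp Require Import all_boot all_fingroup all_solvable all_algebra.
From mathcomp Require Import zify.

Set Implicit Arguments.
Unset Strict Implicit.
Unset Printing Implicit Defensive.

Import FiniteModule GRing.Theory FinRing.Theory.
Local Open Scope ring_scope.

(** Write A for the center of the Frattini subgroup Phi of G, and Q for G /
    Phi, an elementary abelian p-group that acts on A. The hypothesis says that
    every element of A fixed by Q is a trace over Q.

    Two observations about an operator t with t ^ p = 1 on a finite abelian
    p-group W carry the proof. The difference t - 1 is nilpotent. And if the
    fixed points of t are its traces, then counting shows that the kernel of
    the trace is the image of t - 1 ([trace_kernel]). Together they show that a
    t-stable subgroup B of C equals C as soon as every fixed point of t in C is
    the trace of an element of B ([sub_of_traces]). Applied with C the fixed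
    points and B the traces of a subgroup of Q, this propagates the hypothesis
    from Q to all its subgroups ([fixed_are_traces_subgroup]); this replaces
    the theorem that vanishing of one Tate group of a p-group forces
    cohomological triviality.

    For independent x and y in Q acting on W the image B of x - 1 has order at
    least p ^ p ([card_diff_ge]). Otherwise x - 1 and y - 1 vanish on B when
    raised to the power p - 1; as the trace of x is zero on B, expanding it in
    powers of x - 1 gives p B = 0, so the trace of y is zero on B as well, so x
    fixes the fixed points of y, which is impossible. The fixed points of x
    have order at least p ^ 2, and B is isomorphic to the quotient of W by
    them, so that W has order at least p ^ (p + 2). If d(G) > 2 the same
    estimate, applied to the fixed points of a third generator, makes A so
    large that G has order at least p ^ (p + 7).

    When d(G) = 2, Phi is not abelian ([frattini_not_abelian]): otherwise A is
    Phi, a generator x of G can be changed modulo Phi to have order dividing p,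
    because x ^ p is fixed by x and so is a trace; the commutator of x with the
    other generator y then has trace zero, hence is a difference, and y can be
    changed modulo Phi to commute with x. As Phi consists of nongenerators, G
    would be abelian. A nonabelian group is not cyclic modulo its center, so
    the index of A in Phi is at least p ^ 2, and the order of G is at least p ^
    2 times p ^ 2 times p ^ (p + 2).

    Equality forces equality in each estimate. The center of G lies in Phi
    since Q acts faithfully on A, so it is the group of fixed points of Q in A,
    which has order p. If p = 2, then A has order 16 and the fixed points of x
    and of y are elementary abelian of order 4 and meet in a group of order 2;
    they generate 8 elements of order dividing 2. *)

(** * Additive operators on a finite abelian group *)

Section Operators.

Variable V : finZmodType.
Implicit Types (t x y : {additive V -> V}) (u v w : V) (W B C : {group V}).

Lemma memD W u v : u \in W -> v \in W -> u + v \in W.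
Proof. by move=> Wu Wv; rewrite -zmodMgE groupM. Qed.

Lemma memN W u : (- u \in W) = (u \in W).
Proof. by rewrite -zmodVgE groupV. Qed.

Lemma memB W u v : u \in W -> v \in W -> u - v \in W.
Proof. by move=> Wu Wv; rewrite memD ?memN. Qed.

Lemma mem0 W : 0 \in W.
Proof. by rewrite -zmod1gE group1. Qed.

Definition opmorphism t : {morphism [set: V] >-> V} :=
  @Morphism _ _ [set: V] t (in2W (raddfD t)).

(** The kernel and the image of an operator on a subgroup are taken as those
    of a group morphism, so that they are groups. *)
Definition opim t W : {group V} := (opmorphism t @* W)%G.
Definition opker t W : {group V} := ('ker_W (opmorphism t))%G.

Lemma opimP t W v : reflect (exists2 w, w \in W & v = t w) (v \in opim t W).
Proof.
apply: (iffP idP) => [/morphimP[w _ Ww ->]|[w Ww ->]]; first by exists w.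
by apply/morphimP; exists w; rewrite ?inE.
Qed.

Lemma mem_opim t W w : w \in W -> t w \in opim t W.
Proof. by move=> Ww; apply/opimP; exists w. Qed.

Lemma mem_opker t W v : (v \in opker t W) = (v \in W) && (t v == 0).
Proof. by rewrite !inE. Qed.

Lemma card_opim_opker t W : #|W| = (#|opim t W| * #|opker t W|)%N.
Proof.
have := card_isog (first_isog_loc (opmorphism t) (subsetT W)).
rewrite card_quotient; last first.
  by rewrite sub_abelian_norm ?zmod_abelian ?subsetIl.
by move <-; rewrite mulnC Lagrange ?subsetIl.
Qed.

Fact iter_is_zmod_morphism k t : zmod_morphism (iter k t).
Proof. by move=> u v; elim: k => //= k ->; rewrite raddfB. Qed.
HB.instance Definition _ k t :=
  GRing.isZmodMorphism.Build V V (iter k t) (iter_is_zmod_morphism k t).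

Definition optrace n t v := \sum_(i < n) iter i t v.

Fact trace_is_zmod_morphism n t : zmod_morphism (optrace n t).
Proof.
by move=> u v; rewrite /optrace -sumrB; apply: eq_bigr => i _; rewrite raddfB.
Qed.
HB.instance Definition _ n t :=
  GRing.isZmodMorphism.Build V V (optrace n t) (trace_is_zmod_morphism n t).

Definition opdiff t v := t v - v.

Fact diff_is_zmod_morphism t : zmod_morphism (opdiff t).
Proof. by move=> u v; rewrite /opdiff raddfB !opprD addrACA. Qed.
HB.instance Definition _ t :=
  GRing.isZmodMorphism.Build V V (opdiff t) (diff_is_zmod_morphism t).

(** Binomial expansion of the n-th power of 1 + (t - 1). *)
Lemma iter_binomial n t v :
  iter n t v = \sum_(k < n.+1) iter k (opdiff t) v *+ 'C(n, k).
Proof.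
elim: n => [|n IHn]; first by rewrite big_ord1.
have tE w : t w = opdiff t w + w by rewrite /opdiff subrK.
rewrite iterS tE IHn [RHS]big_ord_recl bin0.
under [in RHS]eq_bigr do rewrite lift0 binS mulrnDr.
rewrite big_split addrA [LHS]addrC raddf_sum.
congr (_ + _); last by apply: eq_bigr => i _; rewrite raddfMn.
rewrite [in LHS]big_ord_recl [in RHS]big_ord_recr bin0 /=.
by rewrite bin_small ?mulr0n ?addr0.
Qed.

(** Summing the binomial expansions of the powers of t over i < n adds up each
    column of Pascal's triangle. *)
Lemma trace_binomial n t v :
  optrace n t v = \sum_(k < n) iter k (opdiff t) v *+ 'C(n, k.+1).
Proof.
elim: n => [|n IHn]; first by rewrite /optrace !big_ord0.
rewrite /optrace big_ord_recr /= -/(optrace n t v) IHn iter_binomial.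
under [in RHS]eq_bigr do rewrite binS mulrnDr.
by rewrite big_split /= [in RHS]big_ord_recr /= bin_small // mulr0n addr0.
Qed.

Variable p : nat.
Hypotheses (p_pr : prime p) (pV : p.-group%g [set: V]).

Definition opstable t W := {in W, forall v, t v \in W}.

Lemma stable_iter t W k : opstable t W -> {in W, forall v, iter k t v \in W}.
Proof. by move=> st v Wv; elim: k => //= k; apply: st. Qed.

Lemma stable_trace t W n : opstable t W -> opstable (optrace n t) W.
Proof.
move=> st v Wv; rewrite /= /optrace.
apply: (big_ind (fun u => u \in W)) => [|x y|i _]; first exact: mem0.
  exact: memD.
exact: stable_iter.
Qed.

Lemma stable_diff t W : opstable t W -> opstable (opdiff t) W.
Proof. by move=> st v Wv; rewrite memB ?st. Qed.

Lemma commute_iter t x k : (forall v, t (x v) = x (t v)) ->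
  forall v, iter k t (x v) = x (iter k t v).
Proof. by move=> tx v; elim: k => //= k ->. Qed.

Lemma commute_trace t x n : (forall v, t (x v) = x (t v)) ->
  forall v, optrace n t (x v) = x (optrace n t v).
Proof.
move=> tx v; rewrite /optrace raddf_sum; apply: eq_bigr => i _.
exact: commute_iter.
Qed.

Lemma diff_trace t : iter p t =1 id -> forall v, opdiff t (optrace p t v) = 0.
Proof.
move=> tp v; rewrite /opdiff /optrace -(prednK (prime_gt0 p_pr)) raddf_sum.
rewrite big_ord_recr [in X in _ - X]big_ord_recl /=.
by rewrite -iterS (prednK (prime_gt0 p_pr)) tp addrC subrr.
Qed.

Lemma trace_diff t : iter p t =1 id -> forall v, optrace p t (opdiff t v) = 0.
Proof.
move=> tp v; rewrite commute_trace => [|u]; first exact: diff_trace.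
by rewrite /= /opdiff raddfB.
Qed.

(** Modulo p the p-th power of t - 1 is t ^ p - 1 = 0, so p applications of
    t - 1 land in p V, and p-power multiples of V are eventually zero. *)
Lemma diff_nilpotent t :
  iter p t =1 id -> exists N, forall v, iter N (opdiff t) v = 0.
Proof.
move=> tp.
have step v : exists w, iter p (opdiff t) v = w *+ p.
  have := iter_binomial p t v; rewrite tp.
  rewrite -(big_mkord xpredT (fun k => iter k (opdiff t) v *+ 'C(p, k))).
  rewrite big_nat_recr //= big_ltn ?prime_gt0 //= bin0 binn !mulr1n -addrA.
  rewrite -[LHS]addr0 => /addrI/esym/eqP; rewrite addrC addr_eq0 => /eqP->.
  exists (- \sum_(1 <= i < p) iter i (opdiff t) v *+ ('C(p, i) %/ p)).
  rewrite mulNrn -sumrMnl; congr (- _); apply: eq_big_nat => i i_p.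
  by rewrite -mulrnA divnK ?prime_dvd_bin.
have steps n v : exists w, iter (n * p) (opdiff t) v = w *+ (p ^ n).
  elim: n => [|n [w IHn]]; first by exists v.
  have [w' Dw'] := step w; exists w'.
  by rewrite mulSn iterD IHn raddfMn /= Dw' -mulrnA expnS.
exists (logn p #|[set: V]| * p)%N => v.
have [w ->] := steps (logn p #|[set: V]|) v.
by rewrite -(card_pgroup pV) -zmodXgE expg_cardG ?inE // zmod1gE.
Qed.

(** Apply t - 1 to c repeatedly until just before it falls into B. *)
Lemma relative_fixpoint t B C c : iter p t =1 id -> opstable t C ->
  c \in C -> c \notin B ->
  exists v, [/\ v \in C, v \notin B & opdiff t v \in B].
Proof.
move=> tp stC Cc Bc; have [N nil] := diff_nilpotent tp.
have exk : exists k, iter k (opdiff t) c \in B by exists N; rewrite nil mem0.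
case: (ex_minnP exk) => -[|k] Bk min; first by rewrite Bk in Bc.
exists (iter k (opdiff t) c); split=> //; first exact/stable_iter/Cc/stable_diff.
by apply/negP=> /min; rewrite ltnn.
Qed.

(** For B = C and t of order p this is the vanishing of the Tate group of degree
    0 of the cyclic group generated by t with coefficients in C. *)
Definition fixed_are_traces t C B :=
  forall v, v \in C -> t v = v -> exists2 w, w \in B & v = optrace p t w.

(** The Herbrand quotient of a finite module is 1: as the traces are the whole
    kernel of t - 1, comparing image and kernel of the trace and of t - 1 shows
    that the differences, all of trace zero, are as many as the elements of
    trace zero. *)
Lemma trace_kernel t W : iter p t =1 id -> opstable t W ->
  fixed_are_traces t W W ->
  forall v, v \in W -> optrace p t v = 0 -> exists2 w, w \in W & v = opdiff t w.
Proof.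
move=> tp st fixW v Wv trv0.
have imE : opim (optrace p t) W :=: opker (opdiff t) W.
  apply/setP=> u; apply/opimP/idP=> [[w Ww ->]|].
    by rewrite mem_opker stable_trace //= diff_trace.
  by rewrite mem_opker subr_eq0 => /andP[Wu /eqP/(fixW u Wu)].
have sub : opim (opdiff t) W \subset opker (optrace p t) W.
  apply/subsetP=> _ /opimP[w Ww ->]; rewrite mem_opker stable_diff //=.
  by apply/eqP/trace_diff.
have eqV : opim (opdiff t) W :=: opker (optrace p t) W.
  apply/eqP; rewrite eqEcard sub /=.
  rewrite -(leq_pmul2l (cardG_gt0 (opker (opdiff t) W))).
  by rewrite -{1}imE -card_opim_opker mulnC -card_opim_opker.
by apply/opimP; rewrite eqV mem_opker Wv; apply/eqP.
Qed.

(** An element v of C outside B whose difference lies in B has, by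
    [trace_kernel], the same difference as some w in B; then v - w is fixed,
    hence is the trace of an element of B, and v lies in B after all. *)
Lemma sub_of_traces t B C : iter p t =1 id -> opstable t B -> opstable t C ->
  B \subset C -> fixed_are_traces t C B -> C \subset B.
Proof.
move=> tp stB stC sBC fixC; apply/subsetP=> c Cc; apply/idPn=> Bc.
have [v [Cv Bv Bdv]] := relative_fixpoint tp stC Cc Bc.
have [|w Bw Dw] := trace_kernel tp stB _ Bdv (trace_diff tp v).
  by move=> u Bu; apply/fixC/(subsetP sBC).
have [||w' Bw' D] := fixC (v - w).
  by apply: memB => //; apply: (subsetP sBC).
  rewrite raddfB -(subrK v (t v)) -/(opdiff t v) Dw /opdiff.
  by rewrite addrC -addrA addKr addrC.
by case/negP: Bv; rewrite -(subrK w v) D memD // stable_trace.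
Qed.

(** Each application of t - 1 divides the order of a nontrivial stable subgroup
    by at least p. *)
Lemma small_nilpotent t W k : iter p t =1 id -> opstable t W ->
  (#|W| <= p ^ k)%N -> {in W, forall w, iter k (opdiff t) w = 0}.
Proof.
move=> tp; elim: k W => [|k IHk] W st leW w Ww.
  have /trivgP/subsetP/(_ w Ww) := card_le1_trivg leW.
  by rewrite inE => /eqP.
have [->|w0] := eqVneq w 0; first by rewrite raddf0.
have [|u [Wu u0 du0]] := @relative_fixpoint t 1%G W w tp st Ww.
  by rewrite inE.
rewrite iterSr; apply: (IHk (opim (opdiff t) W)); last exact: mem_opim.
  move=> _ /opimP[v Wv ->]; apply/opimP; exists (t v); first exact: st.
  by rewrite /opdiff raddfB.
have ker_u : u \in opker (opdiff t) W.
  by rewrite mem_opker Wu; rewrite inE in du0.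
have [|_ p_dvd _] := pgroup_pdiv (pgroupS (subsetT (opker (opdiff t) W)) pV).
  by apply/trivgPn; exists u => //; rewrite inE in u0.
rewrite -(leq_pmul2r (prime_gt0 p_pr)) -expnSr (leq_trans _ leW) //.
by rewrite (card_opim_opker (opdiff t) W) leq_mul2l dvdn_leq ?orbT.
Qed.

(** If t acts as the identity, its trace is multiplication by p and the only
    difference is zero, so by [trace_kernel] there is no element of order p. *)
Lemma trivial_action_trivial t W : iter p t =1 id -> opstable t W ->
  fixed_are_traces t W W -> {in W, forall w, t w = w} -> W :=: 1%g.
Proof.
move=> tp st fixW trivW; apply/eqP/idPn=> W1.
have [_ p_dvd _] := pgroup_pdiv (pgroupS (subsetT W) pV) W1.
have [v Wv ov] := Cauchy p_pr p_dvd.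
have [|w Ww Dv] := trace_kernel tp st fixW Wv.
  rewrite /optrace (eq_bigr (fun=> v)) => [|i _].
    by rewrite sumr_const card_ord -zmodXgE -ov expg_order zmod1gE.
  by elim: (i : nat) => //= k ->; apply: trivW.
have v0 : v = 1%g by rewrite Dv /opdiff trivW // subrr zmod1gE.
by have := prime_gt1 p_pr; rewrite -ov v0 order1.
Qed.

Lemma fixpoint_nontrivial t W : iter p t =1 id -> opstable t W ->
  W :!=: 1%g -> opker (opdiff t) W :!=: 1%g.
Proof.
move=> tp st /trivgPn[w Ww w1].
have [|v [Wv v1 dv]] := @relative_fixpoint t 1%G W w tp st Ww.
  by rewrite inE.
apply/trivgPn; exists v; last by rewrite inE in v1.
by rewrite mem_opker Wv; rewrite inE in dv.
Qed.

Lemma pgroup_card_ge W : W :!=: 1%g -> (p <= #|W|)%N.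
Proof.
by move=> W1; have [_ p_dvd _] := pgroup_pdiv (pgroupS (subsetT W) pV) W1;
  rewrite dvdn_leq.
Qed.

(** In [trace_binomial] all binomial coefficients but the last are divisible by
    p, so the hypotheses kill every term but the first. *)
Lemma trace_eq_mulr t c : iter p.-1 (opdiff t) c = 0 ->
  (forall i, iter i.+1 (opdiff t) c *+ p = 0) -> optrace p t c = c *+ p.
Proof.
move=> nil_c pc0; rewrite trace_binomial.
rewrite -(big_mkord xpredT (fun k => iter k (opdiff t) c *+ 'C(p, k.+1))).
rewrite big_ltn ?prime_gt0 // bin1 big_nat_cond big1 ?addr0 //.
case=> // i; rewrite andbT => /andP[_]; rewrite leq_eqVlt => /orP[/eqP Dp|ltip].
  by rewrite (_ : i.+1 = p.-1) ?nil_c ?mul0rn // -Dp.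
have /dvdnP[m ->] : (p %| 'C(p, i.+2))%N by rewrite prime_dvd_bin.
by rewrite mulnC mulrnA pc0 mul0rn.
Qed.

(** The analogue of [fixed_are_traces] for the group generated by two commuting
    operators, whose trace is the composite of the two traces. *)
Definition fixed_are_bitraces x y W :=
  forall v, v \in W -> x v = v -> y v = v ->
  exists2 w, w \in W & v = optrace p y (optrace p x w).

Section TwoOperators.

Variables (x y : {additive V -> V}) (W : {group V}).
Hypotheses (xp : iter p x =1 id) (yp : iter p y =1 id).
Hypothesis (xy : forall v, x (y v) = y (x v)).
Hypotheses (stx : opstable x W) (sty : opstable y W).
Hypothesis fixW : fixed_are_bitraces x y W.

Let stab_y_fix : opstable y (opker (opdiff x) W).
Proof.
move=> v; rewrite !mem_opker !subr_eq0 => /andP[Wv /eqP xv].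
by rewrite sty //= xy xv.
Qed.

Lemma trace_in_fix w : w \in W -> optrace p x w \in opker (opdiff x) W.
Proof. by move=> Ww; rewrite mem_opker stable_trace //=; apply/eqP/diff_trace. Qed.

Lemma bitraces_fix :
  fixed_are_traces y (opker (opdiff x) W) (opker (opdiff x) W).
Proof.
move=> v; rewrite mem_opker subr_eq0 => /andP[Wv /eqP xv] yv.
have [w Ww ->] := fixW Wv xv yv.
by exists (optrace p x w) => //; apply: trace_in_fix.
Qed.

(** Descent from two operators to one: [sub_of_traces] for y compares the traces
    of x with the fixed points of x. *)
Lemma bitraces_traces : fixed_are_traces x W W.
Proof.
move=> v Wv xv; apply/opimP; move: v Wv xv.
suff /subsetP sub : opker (opdiff x) W \subset opim (optrace p x) W.
  by move=> v Wv xv; rewrite sub // mem_opker Wv subr_eq0 xv /=.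
apply: (sub_of_traces yp) => //.
- move=> _ /opimP[w Ww ->]; apply/opimP; exists (y w); first exact: sty.
  exact/esym/commute_trace.
- by apply/subsetP=> _ /opimP[w Ww ->]; apply: trace_in_fix.
move=> v; rewrite mem_opker subr_eq0 => /andP[Wv /eqP xv] yv.
have [w Ww ->] := fixW Wv xv yv.
by exists (optrace p x w) => //; apply: mem_opim.
Qed.

End TwoOperators.

Lemma bitraces_sym x y W : (forall v, x (y v) = y (x v)) ->
  fixed_are_bitraces x y W -> fixed_are_bitraces y x W.
Proof.
move=> xy fixW v Wv yv xv; have [w Ww ->] := fixW v Wv xv yv.
exists w => //; apply: commute_trace => u; apply/esym/commute_trace => {}u.
exact: xy.
Qed.

Section Cardinals.

Variables (x y : {additive V -> V}) (W : {group V}).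
Hypotheses (xp : iter p x =1 id) (yp : iter p y =1 id).
Hypothesis (xy : forall v, x (y v) = y (x v)).
Hypotheses (stx : opstable x W) (sty : opstable y W).
Hypothesis fixW : fixed_are_bitraces x y W.
Hypothesis W1 : W :!=: 1%g.

Let yx v : y (x v) = x (y v). Proof. by rewrite xy. Qed.

(** If the image B of x - 1 were smaller, the (p - 1)-st powers of x - 1 and of
    y - 1 would be zero on B, p would kill B, the trace of y would vanish on B,
    and x would act trivially on the fixed points of y. *)
Lemma card_diff_ge : (p ^ p <= #|opim (opdiff x) W|)%N.
Proof.
set B := opim (opdiff x) W; rewrite leqNgt; apply/negP.
have pB : p.-group%g B by apply: pgroupS pV; apply: subsetT.
rewrite (card_pgroup pB) ltn_exp2l ?prime_gt1 // => ltB.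
have {ltB}leB : (#|B| <= p ^ p.-1)%N.
  by rewrite (card_pgroup pB) leq_exp2l ?prime_gt1 // -ltnS prednK ?prime_gt0.
have stxB : opstable x B.
  move=> _ /opimP[w Ww ->]; apply/opimP; exists (x w); first exact: stx.
  by rewrite /= /opdiff raddfB.
have styB : opstable y B.
  move=> _ /opimP[w Ww ->]; apply/opimP; exists (y w); first exact: sty.
  by rewrite /= /opdiff raddfB yx.
have trx0 b : b \in B -> optrace p x b = 0.
  by case/opimP=> w Ww ->; apply: trace_diff.
have nilx := small_nilpotent xp stxB leB.
have nily := small_nilpotent yp styB leB.
have pB0 b : b \in B -> b *+ p = 0.
  move=> Bb; have Bk k : iter k (opdiff x) b \in B.
    exact/stable_iter/Bb/stable_diff.
  (* Induction down the powers of x - 1: the trace of x is zero on B, and it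
     multiplies an element by p as soon as p kills the images of this element
     under the positive powers of x - 1. *)
  suff: forall k, (k <= p.-1)%N -> iter (p.-1 - k) (opdiff x) b *+ p = 0.
    by move/(_ p.-1 (leqnn _)); rewrite subnn.
  elim=> [_|k IHk ltk]; first by rewrite subn0 nilx ?mul0rn.
  rewrite -(@trace_eq_mulr x) ?trx0 ?nilx // => i.
  rewrite -iterD addSnnS -subSn // subSS iterD -raddfMn /= IHk ?raddf0 //.
  exact: ltnW.
have try0 b : b \in B -> optrace p y b = 0.
  move=> Bb; rewrite trace_eq_mulr ?pB0 ?nily // => i.
  by rewrite -raddfMn pB0 ?raddf0.
have fixy := bitraces_traces yp xp yx sty stx (bitraces_sym xy fixW).
have/negP[] := fixpoint_nontrivial yp sty W1; apply/eqP.
apply: (trivial_action_trivial xp).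
- move=> v; rewrite !mem_opker !subr_eq0 => /andP[Wv /eqP yv].
  by rewrite stx //= yx yv.
- exact: (bitraces_fix yp sty (bitraces_sym xy fixW)).
move=> v; rewrite mem_opker subr_eq0 => /andP[Wv /eqP yv].
have [w Ww ->] := fixy v Wv yv; apply/eqP; rewrite -subr_eq0; apply/eqP.
transitivity (optrace p y (opdiff x w)); last exact/try0/mem_opim.
by rewrite [RHS]raddfB; congr (_ - _); apply/esym/commute_trace.
Qed.

Lemma card_fix2_ge : (p <= #|opker (opdiff y) (opker (opdiff x) W)|)%N.
Proof.
apply: pgroup_card_ge.
apply: (fixpoint_nontrivial yp); last exact: fixpoint_nontrivial.
move=> v; rewrite !mem_opker !subr_eq0 => /andP[Wv /eqP xv].
by rewrite sty //= xy xv.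
Qed.

(** Otherwise y would act trivially on the fixed points of x, where its fixed
    points are traces. *)
Lemma card_diff_fix_ge : (p <= #|opim (opdiff y) (opker (opdiff x) W)|)%N.
Proof.
apply: pgroup_card_ge; apply/eqP=> im1.
have/negP[] := fixpoint_nontrivial xp stx W1; apply/eqP.
apply: (trivial_action_trivial yp).
- move=> v; rewrite !mem_opker !subr_eq0 => /andP[Wv /eqP xv].
  by rewrite sty //= xy xv.
- exact: bitraces_fix.
move=> v Wxv; apply/eqP; rewrite -subr_eq0.
by have := mem_opim (opdiff y) Wxv; rewrite im1 inE.
Qed.

Lemma card_ge : (p ^ (p + 2) <= #|W|)%N.
Proof.
rewrite (card_opim_opker (opdiff x)) (card_opim_opker (opdiff y) (opker _ _)).
rewrite expnD.
by rewrite leq_mul ?card_diff_ge // leq_mul ?card_diff_fix_ge ?card_fix2_ge.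
Qed.

Lemma card_fix_eq : #|W| = (p ^ (p + 2))%N ->
  #|opker (opdiff x) W| = (p ^ 2)%N /\
  #|opker (opdiff y) (opker (opdiff x) W)| = p.
Proof.
have pc := card_diff_ge; have pb := card_diff_fix_ge; have pa := card_fix2_ge.
have p0 : (0 < p)%N := prime_gt0 p_pr.
rewrite (card_opim_opker (opdiff x) W).
rewrite (card_opim_opker (opdiff y) (opker (opdiff x) W)) expnD => oW.
move: pa pb pc oW.
set a := #|opker (opdiff y) _|; set b := #|opim (opdiff y) _|.
set c := #|opim (opdiff x) _|.
move=> pa pb pc card_abc.
have le_ba : (b * a <= p ^ 2)%N.
  by rewrite -(@leq_pmul2l (p ^ p)) ?expn_gt0 ?p0 // -card_abc leq_mul2r pc orbT.
have Dba : (b * a = p ^ 2)%N.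
  by apply/eqP; rewrite eqn_leq le_ba leq_mul.
split=> //; apply/eqP; rewrite eqn_leq pa andbT.
by rewrite -(leq_pmul2l p0) (leq_trans _ le_ba) // leq_mul2r pb orbT.
Qed.

End Cardinals.

End Operators.

(** * Two commuting involutions on a group of order 16 *)

Section OrderSixteen.

Variables (V : finZmodType) (x y : {additive V -> V}) (W : {group V}).
Hypothesis pV : 2.-group%g [set: V].
Hypotheses (xp : iter 2 x =1 id) (yp : iter 2 y =1 id).
Hypothesis (xy : forall v, x (y v) = y (x v)).
Hypotheses (stx : opstable x W) (sty : opstable y W).
Hypothesis fixW : fixed_are_bitraces 2 x y W.
Hypothesis oW : #|W| = 16.

Let W1 : W :!=: 1%g. Proof. by rewrite -cardG_gt1 oW. Qed.

(** The fixed points Wx of x have order 4 and the common fixed points Wxy have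
    order 2, with generator f.  Write f as a trace w + y w.  Since y w - w also
    lies in Wxy and is not zero, it equals f, so w + w = 0.  As w is not in Wxy,
    it generates Wx together with Wxy. *)
Lemma fix_double0 v : v \in opker (opdiff x) W -> v + v = 0.
Proof.
have [oWx oWxy] := card_fix_eq (isT : prime 2) pV xp yp xy stx sty fixW W1 oW.
set Wx := opker (opdiff x) W in oWx oWxy *; set Wxy := opker (opdiff y) Wx in oWxy.
have sty_x : opstable y Wx.
  move=> u; rewrite !mem_opker !subr_eq0 => /andP[Wu /eqP xu].
  by rewrite sty //= xy xu.
have sub : Wxy \subset Wx by apply: subsetIl.
pose dbl : {additive V -> V} := optrace 2 idfun.
have dblE u : dbl u = u + u by rewrite /= /optrace big_ord_recl big_ord1.
have dbl0 u : u \in Wxy -> u + u = 0.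
  by move=> /expg_cardG; rewrite [card _]oWxy zmodXgE zmod1gE mulr2n.
have [f Wf f0] : exists2 f, f \in Wxy & f != 0.
  by apply/trivgPn; rewrite -cardG_gt1 oWxy.
have DWxy : Wxy :=: [set 0; f].
  have of2 : #[f]%g = 2.
    apply/eqP; rewrite eqn_leq order_gt1 f0 andbT dvdn_leq //.
    by have := order_dvdG Wf; rewrite [card _]oWxy.
  apply/esym/eqP; have := cycle2g of2; rewrite zmod1gE => <-.
  by rewrite eqEcard gen_subG sub1set Wf -orderE of2 [card _]oWxy.
have [w Ww Df] : exists2 w, w \in Wx & f = w + y w.
  have := Wf; rewrite mem_opker subr_eq0 => /andP[Wxf /eqP yf].
  have [w Ww ->] := bitraces_fix (isT : prime 2) xp stx fixW Wxf yf.
  by exists w => //; rewrite /optrace big_ord_recl big_ord1.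
have We : opdiff y w \in Wxy.
  rewrite mem_opker stable_diff //=; apply/eqP.
  apply: (small_nilpotent (isT : prime 2) pV yp
            (W := opim (opdiff y) Wx) (k := 1)).
  - move=> _ /opimP[u Wu ->]; apply/opimP; exists (y u); first exact: sty_x.
    by rewrite /= /opdiff raddfB.
  - have := card_opim_opker (opdiff y) Wx; rewrite oWx [#|opker _ _|]oWxy.
    by case: #|_| => [|[|[|]]].
  exact: mem_opim.
have w_notin : w \notin Wxy.
  apply/negP=> Ww'; case/eqP: f0; rewrite Df.
  by move: (Ww'); rewrite mem_opker subr_eq0 => /andP[_ /eqP->]; apply: dbl0.
have e0 : opdiff y w != 0 by apply: contra w_notin; rewrite mem_opker Ww.
have Def : opdiff y w = f.
  by move: We; rewrite DWxy !inE (negPf e0) => /eqP.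
have ww : w + w = 0.
  move: Def; rewrite Df /opdiff addrC => /addIr/eqP; rewrite eq_sym -addr_eq0.
  by move/eqP.
have sub2 : Wxy \proper opker dbl Wx.
  rewrite properE; apply/andP; split.
    apply/subsetP=> u Wu; rewrite mem_opker (subsetP sub) // dblE.
    exact/eqP/dbl0.
  by apply/subsetPn; exists w => //; rewrite mem_opker Ww dblE ww /=.
have /eqP Dk : opker dbl Wx :==: Wx.
  rewrite eqEcard subsetIl oWx.
  have /dvdnP[m] := cardSg (subsetIl Wx ('ker (opmorphism dbl))%g).
  have := proper_card sub2; rewrite /= oWx oWxy.
  by case: m (#|_|) => [|[|m]] [|[|[|[|n]]]] //=.
by rewrite -Dk mem_opker dblE => /andP[_ /eqP].
Qed.

End OrderSixteen.

(** Both groups of fixed points have order 4 and exponent 2 and meet in the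
    common fixed points, of order 2, so that their sum has order 8. *)
Lemma card_double0_ge (V : finZmodType) (x y : {additive V -> V})
    (W : {group V}) :
  2.-group%g [set: V] -> iter 2 x =1 id -> iter 2 y =1 id ->
  (forall v, x (y v) = y (x v)) -> opstable x W -> opstable y W ->
  fixed_are_bitraces 2 x y W -> #|W| = 16 ->
  (8 <= #|[set v in W | (v + v == 0)%R]|)%N.
Proof.
move=> pV xp yp xy stx sty fixW oW.
have yx v : y (x v) = x (y v) by rewrite xy.
have fixW' := bitraces_sym xy fixW.
have W1 : W :!=: 1%g by rewrite -cardG_gt1 oW.
have [oWx oWxy] := card_fix_eq (isT : prime 2) pV xp yp xy stx sty fixW W1 oW.
have [oWy _] := card_fix_eq (isT : prime 2) pV yp xp yx sty stx fixW' W1 oW.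
have := mul_cardG (opker (opdiff x) W) (opker (opdiff y) W); rewrite oWx oWy.
have -> : opker (opdiff x) W :&: opker (opdiff y) W
            = opker (opdiff y) (opker (opdiff x) W).
  by apply/setP=> u; rewrite in_setI !mem_opker; case: (u \in W); rewrite ?andbT.
rewrite oWxy => /eqP; rewrite (_ : 2 ^ 2 * 2 ^ 2 = 8 * 2)%N // eqn_pmul2r //.
move/eqP->; apply/subset_leq_card/subsetP=> _ /mulsgP[u v Wu Wv ->].
rewrite zmodMgE inE addrACA (fix_double0 pV xp yp xy stx sty fixW oW Wu).
rewrite (fix_double0 pV yp xp yx sty stx fixW' oW Wv) addr0 eqxx andbT.
by move: Wu Wv; rewrite !mem_opker => /andP[Wu _] /andP[Wv _]; apply: memD.
Qed.

(** * Actions of elementary abelian groups *)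

Section ElementaryAction.

Variables (aT : finGroupType) (V : finZmodType) (p : nat) (Q : {group aT}).
Variable op : aT -> {additive V -> V}.
Hypotheses (p_pr : prime p) (pV : p.-group%g [set: V]).
Hypothesis abelQ : p.-abelem%g Q.
Hypothesis op1 : op 1%g =1 id.
Hypothesis opM : {in Q &, forall g h v, op (g * h)%g v = op h (op g v)}.
Implicit Types (H : {group aT}) (v w : V).

Lemma op_commute g h v : g \in Q -> h \in Q -> op g (op h v) = op h (op g v).
Proof.
move=> Qg Qh; rewrite -!opM //.
by rewrite (centsP (abelem_abelian abelQ) _ Qg _ Qh).
Qed.

Lemma op_expg g i v : g \in Q -> op (g ^+ i)%g v = iter i (op g) v.
Proof.
move=> Qg; elim: i => [|i IHi] /=; first by rewrite expg0 op1.
by rewrite expgSr opM ?groupX // IHi.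
Qed.

Lemma op_iter_p g : g \in Q -> iter p (op g) =1 id.
Proof.
move=> Qg v; case/(abelemP p_pr): abelQ => _ expQ.
by rewrite -op_expg // expQ // op1.
Qed.

Definition group_trace H v := \sum_(h in H) op h v.

Fact group_trace_is_zmod_morphism H : zmod_morphism (group_trace H).
Proof.
by move=> u v; rewrite /group_trace -sumrB; apply: eq_bigr => h _; rewrite raddfB.
Qed.
HB.instance Definition _ H :=
  GRing.isZmodMorphism.Build V V (group_trace H)
    (group_trace_is_zmod_morphism H).

Lemma group_trace_op H h v : H \subset Q -> h \in H ->
  group_trace H (op h v) = group_trace H v.
Proof.
move=> sHQ Hh; rewrite /group_trace [RHS](reindex_inj (mulgI h)) /=.
apply: eq_big => k; first by rewrite groupMl.
by move=> Hk; rewrite opM ?(subsetP sHQ).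
Qed.

Lemma op_group_trace H g v : H \subset Q -> g \in Q ->
  op g (group_trace H v) = group_trace H (op g v).
Proof.
move=> sHQ Qg; rewrite /group_trace raddf_sum; apply: eq_bigr => h Hh.
exact: op_commute (subsetP sHQ h Hh).
Qed.

Lemma join_cycleE H g : H \subset Q -> g \in Q ->
  (H <*> <[g]>)%g = (H * <[g]>)%g.
Proof.
move=> sHQ Qg; apply/comm_joingE/centC; apply: subset_trans sHQ _.
apply: subset_trans (abelem_abelian abelQ) (centS _).
by rewrite cycle_subG.
Qed.

Lemma group_trace1 v : group_trace 1%G v = v.
Proof. by rewrite /group_trace big_set1 op1. Qed.

(** The join is the direct product of H and the cyclic group of order p
    generated by g, so its trace is a composite of traces. *)
Lemma group_trace_join H g v : H \subset Q -> g \in Q -> g \notin H ->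
  group_trace (H <*> <[g]>)%G v = optrace p (op g) (group_trace H v).
Proof.
move=> sHQ Qg Hg.
have og : #[g]%g = p.
  by apply: (abelem_order_p abelQ Qg); apply: contra Hg => /eqP->.
have tiHg : H :&: <[g]>%g = 1%g.
  by rewrite setIC prime_TIg -?orderE ?og // cycle_subG.
pose f (u : aT * 'I_p) := (u.1 * g ^+ u.2)%g.
pose D : {set aT * 'I_p} := setX H setT.
have DK : (H <*> <[g]>)%g = f @: D.
  rewrite join_cycleE //; apply/setP=> k; apply/mulsgP/imsetP.
    case=> h _ Hh /cycleP[i ->] ->.
    exists (h, Ordinal (ltn_pmod i (prime_gt0 p_pr))); first by rewrite !inE Hh.
    by rewrite /f /= -og -expg_mod_order.
  case=> -[h i]; rewrite !inE andbT /= => Hh ->.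
  by exists h (g ^+ i)%g => //; rewrite mem_cycle.
have injf : {in D &, injective f}.
  case=> [h i] [h' i']; rewrite !inE !andbT /= /f /= => Hh Hh' E.
  have Ehg : (h'^-1 * h = g ^+ i' * g ^- i)%g.
    by rewrite -[h](mulgK (g ^+ i)%g) E -mulgA mulKg.
  have : (h'^-1 * h)%g \in H :&: <[g]>%g.
    by rewrite inE groupM ?groupV // Ehg groupM ?groupV ?mem_cycle.
  rewrite tiHg => /set1P hh'; have Dh : h = h'.
    by apply/esym/eqP; rewrite eq_mulVg1 hh'.
  congr (_, _) => //; apply/val_inj/eqP; move: E; rewrite Dh => /mulgI/eqP.
  by rewrite eq_expg_mod_order og !modn_small.
rewrite /group_trace /= DK big_imset //=.
transitivity (\sum_(h in H) \sum_(i < p) op (h * g ^+ i)%g v).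
  by rewrite pair_big; apply: eq_bigl => -[h i]; rewrite !inE.
rewrite /optrace exchange_big; apply: eq_bigr => i _; rewrite raddf_sum.
apply: eq_bigr => h Hh; rewrite /= -op_expg // opM ?groupX //.
exact: (subsetP sHQ).
Qed.

Lemma fix_join H g v : H \subset Q -> g \in Q ->
  {in H, forall h, op h v = v} -> op g v = v ->
  {in (H <*> <[g]>)%G, forall k, op k v = v}.
Proof.
move=> sHQ Qg fixH fixg k; rewrite /= join_cycleE //.
case/mulsgP=> h _ Hh /cycleP[i ->] ->.
rewrite opM ?groupX ?(subsetP sHQ h Hh) //.
by rewrite fixH // op_expg //; elim: i => //= i ->.
Qed.

Lemma card_join_cycle_le H g : H \subset Q -> g \in Q ->
  (#|(H <*> <[g]>)%G| <= #|H| * p)%N.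
Proof.
move=> sHQ Qg; rewrite /= join_cycleE //.
apply: (leq_trans (n := (#|H| * #[g]%g)%N)).
  by rewrite mul_cardG leq_pmulr ?cardG_gt0.
rewrite leq_pmul2l ?cardG_gt0 // dvdn_leq ?prime_gt0 // order_dvdn.
by case/(abelemP p_pr): abelQ => _ ->.
Qed.

Lemma exists_outside H : H \subset Q -> (#|H| < #|Q|)%N ->
  exists2 g, g \in Q & g \notin H.
Proof.
move=> sHQ ltHQ; apply/subsetPn; apply: contraL ltHQ => /subset_leq_card.
by rewrite leqNgt.
Qed.

(** Vanishing of the Tate group of degree 0 of H with coefficients in V. *)
Definition traces_onto_fixed H := forall v, (forall h, h \in H -> op h v = v) ->
  exists w, v = group_trace H w.

(** Descend from Q to H one factor of order p at a time.  When the statement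
    holds for the join of H and g, [sub_of_traces] for g shows that the fixed
    points of H are the traces over H. *)
Lemma fixed_are_traces_subgroup H :
  traces_onto_fixed Q -> H \subset Q -> traces_onto_fixed H.
Proof.
move=> traceQ; have [n] := ubnP (#|Q| - #|H|)%N.
elim: n H => // n IHn H; rewrite ltnS => leHn sHQ.
have [sQH | /subsetPn[g Qg Hg]] := boolP (Q \subset H).
  have -> : H = Q by apply/group_inj/eqP; rewrite eqEsubset sHQ.
  exact: traceQ.
set K := (H <*> <[g]>)%G.
have sKQ : K \subset Q by rewrite join_subG sHQ cycle_subG.
have gK : g \in K by rewrite (subsetP (joing_subr _ _)) ?cycle_id.
have sHK : H \subset K := joing_subl _ _.
have traceK : traces_onto_fixed K.
  apply: IHn => //; apply: leq_trans leHn.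
  have prop (L : {group aT}) : H \subset L -> g \in L -> (#|H| < #|L|)%N.
    move=> sHL Lg; rewrite proper_card // properE sHL.
    by apply/subsetPn; exists g.
  by rewrite ltn_sub2l ?prop.
pose C := [set v | [forall h in H, op h v == v]].
have CP v : reflect {in H, forall h, op h v = v} (v \in C).
  by rewrite inE; apply: 'forall_in_eqP.
have gC : group_set C.
  apply/group_setP; split; first by apply/CP=> h _; rewrite zmod1gE raddf0.
  move=> u v /CP fixu /CP fixv; apply/CP=> h Hh.
  by rewrite zmodMgE raddfD fixu ?fixv.
pose Cg := Group gC; pose B := opim (group_trace H) [set: V]%G.
have sBC : B \subset Cg.
  apply/subsetP=> _ /opimP[w _ ->]; apply/CP=> h Hh.
  by rewrite /= op_group_trace ?group_trace_op //; apply: (subsetP sHQ).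
have stB : opstable (op g) B.
  move=> _ /opimP[w _ ->]; rewrite /= op_group_trace //.
  by apply: mem_opim; rewrite inE.
have stC : opstable (op g) Cg.
  move=> v /CP fixv; apply/CP=> h Hh.
  by rewrite op_commute ?(subsetP sHQ h Hh) // fixv.
have fixC : fixed_are_traces p (op g) Cg B.
  move=> v /CP fixv gv; have [|w ->] := traceK v.
    exact: fix_join.
  exists (group_trace H w); last exact: group_trace_join.
  by apply: mem_opim; rewrite inE.
move=> v fixv.
have /subsetP/(_ v) := sub_of_traces p_pr pV (op_iter_p Qg) stB stC sBC fixC.
by case/(_ (introT (CP v) fixv))/opimP=> w _ ->; exists w.
Qed.

Hypothesis traceQ : traces_onto_fixed Q.
Local Notation Vt := [set: V]%G.

(** The trivial factor makes the cyclic group generated by x the first of a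
    chain of joins to which [group_trace_join] applies. *)
Let cycE x := ([1 aT]%G <*> <[x]>)%G.

Let cycE_Q x : x \in Q -> cycE x \subset Q.
Proof. by move=> Qx; rewrite join_subG sub1G cycle_subG. Qed.

Lemma cyclic_fixed_are_traces x :
  x \in Q -> x != 1%g -> fixed_are_traces p (op x) Vt Vt.
Proof.
move=> Qx x1 v _ fixv.
have [|w ->] := fixed_are_traces_subgroup traceQ (cycE_Q Qx) (v := v).
  by apply: fix_join; rewrite ?sub1G // => h /set1P->; apply: op1.
by exists w; rewrite ?inE // group_trace_join ?sub1G ?inE // group_trace1.
Qed.

(** An element acting trivially has the trace v |-> p v, whose image is not all
    of V. *)
Lemma op_faithful x : x \in Q -> x != 1%g -> Vt :!=: 1%g ->
  exists v, op x v != v.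
Proof.
move=> Qx x1 V1; apply/existsP/negbNE; rewrite negb_exists.
apply/negP=> /forallP fixV; case/negP: V1; apply/eqP.
apply: (trivial_action_trivial p_pr pV (op_iter_p Qx)) => [v||v _].
- by rewrite !inE.
- exact: cyclic_fixed_are_traces.
exact/eqP/negbNE/fixV.
Qed.

Lemma bicyclic_fixed_are_traces x y :
  x \in Q -> x != 1%g -> y \in Q -> y \notin cycE x ->
  fixed_are_bitraces p (op x) (op y) Vt.
Proof.
move=> Qx x1 Qy xNy v _ xv yv.
have sK : (cycE x <*> <[y]>)%G \subset Q.
  by rewrite join_subG cycE_Q ?cycle_subG.
have [|w ->] := fixed_are_traces_subgroup traceQ sK (v := v).
  apply: fix_join; rewrite ?cycE_Q //.
  by apply: fix_join; rewrite ?sub1G // => h /set1P->; apply: op1.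
exists w; rewrite ?inE // group_trace_join ?cycE_Q //.
by rewrite group_trace_join ?sub1G ?inE // group_trace1.
Qed.

(** The trace over the group generated by z, x and y factors through the fixed
    points of z. *)
Lemma bicyclic_fixed_are_traces_on_fix z x y : z \in Q -> z != 1%g -> x \in Q ->
  x \notin cycE z -> y \in Q -> y \notin (cycE z <*> <[x]>)%G ->
  fixed_are_bitraces p (op x) (op y) (opker (opdiff (op z)) Vt).
Proof.
move=> Qz z1 Qx zNx Qy yN v; rewrite mem_opker inE subr_eq0 => /eqP zv xv yv.
have sKx : (cycE z <*> <[x]>)%G \subset Q.
  by rewrite join_subG cycE_Q ?cycle_subG.
have sK : (cycE z <*> <[x]> <*> <[y]>)%G \subset Q.
  by rewrite join_subG sKx cycle_subG.
have [|w ->] := fixed_are_traces_subgroup traceQ sK (v := v).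
  do 2![apply: fix_join; rewrite ?cycE_Q //].
  by apply: fix_join; rewrite ?sub1G // => h /set1P->; apply: op1.
exists (optrace p (op z) w).
  by apply: (trace_in_fix p_pr (op_iter_p Qz)) => [u|]; rewrite !inE.
rewrite group_trace_join // group_trace_join ?cycE_Q //.
by rewrite group_trace_join ?sub1G ?inE // group_trace1.
Qed.

Let card_cycE x : x \in Q -> (#|cycE x| <= p)%N.
Proof.
by move=> Qx; have := card_join_cycle_le (sub1G Q) Qx; rewrite cards1 mul1n.
Qed.

Lemma exists_independent2 : (p ^ 2 <= #|Q|)%N -> exists x y,
  [/\ x \in Q, x != 1%g, y \in Q & y \notin cycE x].
Proof.
move=> leQ; have p1 := prime_gt1 p_pr.
have [|x Qx] := @exists_outside [1 aT]%G (sub1G Q).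
  by rewrite cards1 (leq_trans _ leQ) // (leq_trans p1) // leq_pmulr // ltnW.
rewrite inE => x1.
have [|y Qy yN] := exists_outside (cycE_Q Qx); last by exists x, y.
rewrite (leq_ltn_trans (card_cycE Qx)) // (leq_trans _ leQ) //.
by rewrite ltn_Pmulr // ltnW.
Qed.

Hypothesis V1 : Vt :!=: 1%g.

Let stabT (t : {additive V -> V}) : opstable t Vt.
Proof. by move=> v; rewrite !inE. Qed.

Lemma card_ge_of_rank2 : (p ^ 2 <= #|Q|)%N -> (p ^ (p + 2) <= #|V|)%N.
Proof.
move=> /exists_independent2[x [y [Qx x1 Qy yN]]]; rewrite -cardsT.
apply: (card_ge p_pr pV (op_iter_p Qx) (op_iter_p Qy)) => // [v|].
  exact: op_commute.
exact: bicyclic_fixed_are_traces.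
Qed.

(** Split V by an element z into the image and the kernel of z - 1.  The
    image has order at least p ^ p, and the remaining rank 2 acts on the kernel,
    the fixed points of z, as in [card_ge_of_rank2]. *)
Lemma card_ge_of_rank3 : (p ^ 3 <= #|Q|)%N -> (p ^ (p + 4) <= #|V|)%N.
Proof.
move=> leQ; have p1 := prime_gt1 p_pr; have p0 := ltnW p1.
have [|z [x [Qz z1 Qx xN]]] := exists_independent2.
  by rewrite (leq_trans _ leQ) // leq_exp2l.
have sK : (cycE z <*> <[x]>)%G \subset Q.
  by rewrite join_subG cycE_Q ?cycle_subG.
have [|y Qy yN] := exists_outside sK.
  rewrite (leq_ltn_trans (card_join_cycle_le (cycE_Q Qz) Qx)) //.
  rewrite (@leq_ltn_trans (p ^ 2)) // ?leq_mul2r ?card_cycE ?orbT //.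
  by rewrite (leq_trans _ leQ) // ltn_exp2l.
have zp := op_iter_p Qz.
rewrite -cardsT (card_opim_opker (opdiff (op z)) Vt).
rewrite (_ : p + 4 = 2 + (p + 2))%N; last by rewrite addnCA.
rewrite expnD.
have W1 := fixpoint_nontrivial p_pr pV zp (@stabT _) V1.
have stW q : q \in Q -> opstable (op q) (opker (opdiff (op z)) Vt).
  move=> Qq v; rewrite !mem_opker !inE !subr_eq0 => /eqP zv.
  by rewrite op_commute // zv eqxx.
rewrite leq_mul //; last first.
  apply: (card_ge p_pr pV (op_iter_p Qx) (op_iter_p Qy)) => //; first 1 last.
  - exact: stW.
  - exact: stW.
  - exact: bicyclic_fixed_are_traces_on_fix.
  by move=> v; apply: op_commute.
apply: (@leq_trans (p ^ p)); first by rewrite leq_exp2l.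
apply: (card_diff_ge p_pr pV zp (op_iter_p Qx)) => // [v|].
  exact: op_commute.
exact: bicyclic_fixed_are_traces.
Qed.

Lemma exists_generators2 : #|Q| = (p ^ 2)%N -> exists x y,
  [/\ x \in Q, x != 1%g, y \in Q, y \notin cycE x &
     (cycE x <*> <[y]>)%G = Q].
Proof.
move=> oQ.
have [|x [y [Qx x1 Qy yN]]] := exists_independent2; first by rewrite oQ.
exists x, y; split=> //.
have sK : (cycE x <*> <[y]>)%G \subset Q.
  by rewrite join_subG cycE_Q ?cycle_subG.
apply/group_inj/eqP; rewrite eqEcard sK oQ.
have pK := pgroupS sK (abelem_pgroup abelQ).
have lt0 : (0 < logn p #|cycE x|)%N.
  rewrite -(logn1 p) -(cards1 (1%g : aT)); apply: properG_ltn_log.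
    exact: pgroupS (cycE_Q Qx) (abelem_pgroup abelQ).
  rewrite proper1G; apply/trivgPn; exists x => //.
  by rewrite (subsetP (joing_subr _ _)) ?cycle_id.
have lt1 : (logn p #|cycE x| < logn p #|(cycE x <*> <[y]>)%G|)%N.
  apply: properG_ltn_log => //; rewrite properE joing_subl.
  apply/subsetPn; exists y => //.
  by rewrite (subsetP (joing_subr _ _)) ?cycle_id.
rewrite [X in (_ <= X)%N](card_pgroup pK) (leq_exp2l _ _ (prime_gt1 p_pr)).
exact: leq_ltn_trans lt0 lt1.
Qed.

Lemma card_fixed : #|Q| = (p ^ 2)%N -> #|V| = (p ^ (p + 2))%N ->
  #|[set v | [forall q in Q, op q v == v]]| = p.
Proof.
move=> oQ; rewrite -cardsT => oV; have p0 := prime_gt0 p_pr.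
have [x [y [Qx x1 Qy yN DQ]]] := exists_generators2 oQ.
have xy v : op x (op y v) = op y (op x v) by apply: op_commute.
have [_ <-] := card_fix_eq p_pr pV (op_iter_p Qx) (op_iter_p Qy) xy (@stabT _)
  (@stabT _) (bicyclic_fixed_are_traces Qx x1 Qy yN) V1 oV.
have sK : (cycE x <*> <[y]>)%G \subset Q.
  by rewrite join_subG cycE_Q ?cycle_subG.
apply: eq_card => v; rewrite inE !mem_opker inE !subr_eq0 /=.
apply/'forall_in_eqP/andP => [fixv | [/eqP xv /eqP yv]].
  by rewrite !fixv.
rewrite -DQ; apply: fix_join; rewrite ?cycE_Q //.
by apply: fix_join; rewrite ?sub1G // => h /set1P->; apply: op1.
Qed.

Lemma card_double0 : p = 2 -> (4 <= #|Q|)%N -> #|V| = 16 ->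
  (8 <= #|[set v : V | (v + v == 0)%R]|)%N.
Proof.
move=> p2 leQ oV; have [|x [y [Qx x1 Qy yN]]] := exists_independent2.
  by rewrite p2.
have fixV := bicyclic_fixed_are_traces Qx x1 Qy yN.
move: pV (op_iter_p Qx) (op_iter_p Qy) fixV; rewrite p2 => p2V xp yp fixV.
have -> : [set v : V | (v + v == 0)%R] = [set v in Vt | (v + v == 0)%R].
  by apply/setP=> v; rewrite !inE.
apply: (card_double0_ge p2V xp yp) => // [v|]; first exact: op_commute.
by rewrite cardsT.
Qed.

End ElementaryAction.

(** * Abelian groups of order 16 with eight elements of order dividing 2 *)

Close Scope ring_scope.
Local Open Scope group_scope.

(** The rank is at least 3, and the only factorisations of 16 into at least
    three factors greater than 1 are 4 * 2 * 2 and 2 * 2 * 2 * 2. *)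
Lemma abelian_type16 (gT : finGroupType) (A : {group gT}) :
  abelian A -> #|A| = 16 -> (8 <= #|[set a in A | (a * a == 1)%g]|)%N ->
  abelian_type A = [:: 2; 2; 2; 2] \/ abelian_type A = [:: 4; 2; 2].
Proof.
move=> abA oA le8.
have p2A : 2.-group A by rewrite /pgroup oA.
have r3 : (3 <= 'r(A))%N.
  rewrite (rank_pgroup p2A) (p_rank_abelian _ abA).
  rewrite -(leq_exp2l (m := 2)) // -card_pgroup; last first.
    exact: pgroupS (Ohm_sub 1 A) p2A.
  rewrite /= (OhmEabelian p2A (abelianS (Ohm_sub 1 A) abA)).
  apply: leq_trans le8 (subset_leq_card _); apply/subsetP=> a.
  by rewrite !inE expgS expg1.
have := abelian_type_gt1 A; have := abelian_type_sorted A.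
have [b defA Db] := abelian_structure abA.
have := bigdprod_card defA; rewrite oA.
have -> : (\prod_(x <- b) #|<[x]>|)%N = (\prod_(m <- abelian_type A) m)%N.
  by rewrite -Db big_map.
move: r3; rewrite -(size_abelian_type abA).
case: (abelian_type A) => [|a1 [|a2 [|a3 s]]] //= _.
rewrite !big_cons => prodA /and3P[a21 a32 _] /and4P[a1gt a2gt a3gt sgt].
have pos r : all [pred m | (m > 1)%N] r -> (0 < \prod_(m <- r) m)%N.
  by move=> rgt; rewrite big_seq prodn_cond_gt0 // => j /(allP rgt)/ltnW.
have prod1 r : all [pred m | (m > 1)%N] r ->
    (\prod_(m <- r) m <= 1)%N -> r = [::].
  case: r => //= m r /andP[m1 rgt]; rewrite big_cons.
  by have := pos r rgt; nia.
have sE r : all [pred m | (m > 1)%N] r ->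
    (\prod_(m <- r) m = 2)%N -> r = [:: 2].
  case: r => [|m r] /=; first by rewrite big_nil.
  rewrite big_cons => /andP[m1 rgt] mr2; have r_gt0 := pos r rgt.
  have m2 : m = 2 by nia.
  by rewrite m2 (prod1 r) //; nia.
have s_gt0 := pos s sgt.
have le4 : (a1 <= 4)%N.
  rewrite leqNgt; apply/negP=> a1_5.
  have : (5 * (2 * (2 * 1)) <= a1 * (a2 * (a3 * \prod_(j <- s) j)))%N.
    by rewrite !leq_mul.
  by rewrite prodA.
have [Da1|[Da1|Da1]] : a1 = 2 \/ a1 = 3 \/ a1 = 4 by lia.
- have [Da2 Da3] : a2 = 2 /\ a3 = 2 by lia.
  by left; rewrite Da1 Da2 Da3 (sE s) //; nia.
- by nia.
have [Da2 Da3] : a2 = 2 /\ a3 = 2 by nia.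
by right; rewrite Da1 Da2 Da3 (prod1 s) //; nia.
Qed.

(** Both model groups satisfy the hypotheses of [abelian_type16]; the first has
    exponent 2 and the second has an element of order 4, which decides which
    type belongs to which. *)
Lemma abelian16_isog (gT : finGroupType) (A : {group gT}) :
  abelian A -> #|A| = 16 -> (8 <= #|[set a in A | (a * a == 1)%g]|)%N ->
  A \isog [set: 'Z_2 * 'Z_2 * 'Z_2 * 'Z_2] \/ A \isog [set: 'Z_4 * 'Z_2 * 'Z_2].
Proof.
move=> abA oA le8.
have Z2 (b : 'Z_2) : (b * b = 1)%g by apply/val_inj; case: b => [[|[|]]].
set T1 := ('Z_2 * 'Z_2 * 'Z_2 * 'Z_2)%type; set T2 := ('Z_4 * 'Z_2 * 'Z_2)%type.
have ZC n : abelian [set: 'Z_n] := zmod_abelian _.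
have ab1 : abelian [set: T1].
  apply/centsP=> -[[[a b] c] d] _ [[[a' b'] c'] d'] _.
  by congr (_, _, _, _); apply: (centsP (ZC _)); rewrite inE.
have ab2 : abelian [set: T2].
  apply/centsP=> -[[a b] c] _ [[a' b'] c'] _.
  by congr (_, _, _); apply: (centsP (ZC _)); rewrite inE.
have o1 : #|[set: T1]| = 16 by rewrite cardsT !card_prod !card_ord.
have o2 : #|[set: T2]| = 16 by rewrite cardsT !card_prod !card_ord.
have ex1 (t : T1) : (t * t = 1)%g.
  by case: t => [[[a b] c] d]; congr (_, _, _, _); apply: Z2.
have le1 : (8 <= #|[set a in [set: T1] | (a * a == 1)%g]|)%N.
  rewrite (_ : [set a in _ | _] = [set: T1]) ?o1 //.
  by apply/setP=> t; rewrite !inE ex1 eqxx.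
have le2 : (8 <= #|[set a in [set: T2] | (a * a == 1)%g]|)%N.
  pose B : {set T2} := setX (setX [set (0 : 'Z_4)%R; (2%:R : 'Z_4)%R] setT) setT.
  have oB : #|B| = 8 by rewrite !cardsX cards2 !cardsT !card_ord.
  apply: leq_trans (eq_leq (esym oB)) (subset_leq_card _).
  apply/subsetP=> -[[a b] c].
  rewrite !inE !andbT /= => Ha; apply/eqP.
  congr (_, _, _); [|exact: Z2|exact: Z2].
  by case/orP: Ha => /eqP->; apply/val_inj.
have t1 : abelian_type [set: T1] = [:: 2; 2; 2; 2].
  have [//|bad] := abelian_type16 ab1 o1 le1.
  have : 2.-abelem [set: T1].
    by apply/(abelemP (isT : prime 2)); split=> // t _; rewrite expgS expg1.
  move/abelian_type_abelem; rewrite bad => /esym.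
  by case: ('r(_)) => //= n [].
have t2 : abelian_type [set: T2] = [:: 4; 2; 2].
  have [bad|//] := abelian_type16 ab2 o2 le2.
  have : [set: T2] \isog [set: T1] by rewrite eq_abelian_type_isog // bad t1.
  case/isogP=> f injf _; have : f (1%R, 1%R, 1%R) ^+ 2 = 1%g.
    by rewrite expgS expg1 ex1.
  rewrite -morphX ?inE // -(morph1 f) => /(injmP injf).
  by rewrite !inE => /(_ isT isT).
have [tA|tA] := abelian_type16 abA oA le8; [left | right];
  by rewrite eq_abelian_type_isog // tA (t1, t2).
Qed.





(** * Conjugation on an abelian normal subgroup *)

Section FiniteModuleConj.

Variables (gT : finGroupType) (A : {group gT}) (abA : abelian A).

Definition conjop (x : gT) (u : fmod_of abA) : fmod_of abA := u ^@ x.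

Fact conjop_is_zmod_morphism x : zmod_morphism (conjop x).
Proof. by move=> u v; rewrite /conjop actAr actNr. Qed.
HB.instance Definition _ x :=
  GRing.isZmodMorphism.Build _ _ (conjop x) (conjop_is_zmod_morphism x).

Lemma fmval_conjop x u : x \in 'N(A) -> fmval (conjop x u) = (fmval u ^ x)%g.
Proof. exact: fmvalJ. Qed.

Lemma conjopM x y u : x \in 'N(A) -> y \in 'N(A) ->
  conjop (x * y)%g u = conjop y (conjop x u).
Proof. by move=> Nx Ny; apply: actrM. Qed.

Lemma isog_fmod : A \isog [set: fmod_of abA].
Proof.
apply/isogP; exists (fmod_morphism abA); first exact: injm_fmod.
apply/setP=> u; rewrite inE -[u]fmvalK; apply/morphimP; exists (fmval u) => //.
  exact: fmodP.
exact: fmodP.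
Qed.

(** Moving the factors u to the right past the factors x conjugates them by the
    successive powers of x. *)
Lemma expg_mul_fmod x u n : x \in 'N(A) ->
  (x * fmval u) ^+ n = x ^+ n * fmval (optrace n (conjop x) u).
Proof.
move=> Nx; elim: n => [|n IHn]; first by rewrite /optrace big_ord0 /= mulg1.
have -> : optrace n.+1 (conjop x) u = (conjop x (optrace n (conjop x) u) + u)%R.
  by rewrite /optrace big_ord_recl addrC [in RHS]raddf_sum.
rewrite expgSr IHn expgSr; set T := optrace n _ u.
transitivity (x ^+ n * x * (fmval T ^ x * fmval u)).
  by rewrite conjgE !mulgA mulgK.
by rewrite -fmval_conjop.
Qed.

End FiniteModuleConj.

(** * The center of the Frattini subgroup of an NS-group *)

Section FrattiniCenter.

Variables (gT : finGroupType) (p : nat) (G : {group gT}).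
Hypotheses (p_pr : prime p) (nsG : NS_group p G).

Local Notation P := 'Phi(G)%G.
Local Notation A := 'Z('Phi(G))%G.
Local Notation abA := (center_abelian 'Phi(G)).
Local Notation V := (fmod_of abA).
Local Notation Q := (G / 'Phi(G))%G.

Lemma NS_pgroup : p.-group%g G. Proof. by case: nsG. Qed.
Let nPG : G \subset 'N('Phi(G)). Proof. exact: normal_norm (Phi_normal G). Qed.
Let nAN : 'N('Phi(G)) \subset 'N('Z('Phi(G))).
Proof. exact: char_norms (center_char _). Qed.

(** Elements of Phi centralise A, so any representative of the coset gives the
    same operator ([coset_opE]). *)
Definition coset_op (q : coset_of 'Phi(G)) : {additive V -> V} :=
  conjop (repr q).

Lemma coset_opE x u :
  x \in 'N('Phi(G)) -> coset_op (coset 'Phi(G) x) u = conjop x u.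
Proof.
move=> Nx; apply: fmod_inj; set q := coset _ x.
have Nq : repr q \in 'N('Phi(G)) by rewrite repr_coset_norm.
rewrite !fmval_conjop ?(subsetP nAN) //.
have : (x^-1 * repr q)%g \in 'Phi(G).
  apply: coset_idr; rewrite ?groupM ?groupV // morphM ?groupV // morphV //.
  by rewrite /= coset_reprK mulVg.
set z := (_ * _)%g => Pz; have -> : repr q = (x * z)%g by rewrite mulKVg.
have Aux : fmval u ^ x \in 'Z('Phi(G)).
  by rewrite memJ_norm ?(subsetP nAN) // fmodP.
rewrite conjgM; apply/conjg_fixP/commgP.
by have [_ /centP/(_ z Pz)] := setIP Aux.
Qed.

Let op1 : coset_op 1%g =1 id.
Proof.
by move=> u; rewrite -(morph1 (coset 'Phi(G))) coset_opE //; apply: actr1.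
Qed.

Let opM :
  {in Q &, forall g h v, coset_op (g * h)%g v = coset_op h (coset_op g v)}.
Proof.
move=> _ _ /morphimP[g Ng Gg ->] /morphimP[h Nh Gh ->] v.
by rewrite -morphM // !coset_opE ?groupM // conjopM ?(subsetP nAN).
Qed.

Let abelQ : p.-abelem%g Q.
Proof. exact: Phi_quotient_abelem NS_pgroup. Qed.

Let pV : p.-group%g [set: V].
Proof.
rewrite -(isog_pgroup _ (isog_fmod abA)).
by rewrite (pgroupS _ NS_pgroup) // (subset_trans (center_sub _)) ?Phi_sub.
Qed.

(** The traces already form a group, so the quotient defining the Tate group is
    trivial only if every fixed point is a trace. *)
Lemma NS_fixed_are_traces : traces_onto_fixed coset_op Q.
Proof.
case: nsG => _ _ H0 v fixv.
have [acts actE] := frattini_center_module G.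
have trG := tate_trace_group_set abA acts.
have sub := tate_trace_sub abA acts.
have : 'C_('Z('Phi(G)) | ('J %% 'Phi(G))%gact)(Q)%g
         \subset (tate_trace ('J %% 'Phi(G))%gact Q @: A).
  move/trivgP: H0; rewrite quotient_sub1 /= ?gen_set_id //.
    by apply: sub_abelian_norm sub; apply: abelianS (subsetIl _ _) abA.
have opE q u : q \in Q -> fmval (coset_op q u) = ('J %% 'Phi(G))%act (fmval u) q.
  case/morphimP=> g Ng Gg ->; rewrite actE ?fmodP // coset_opE //.
  by rewrite fmval_conjop ?(subsetP nAN).
move=> /subsetP sub_tr.
have /sub_tr/imsetP[b Ab Dv] : fmval v \in 'C_(A | 'J %% 'Phi(G))(Q).
  have [actQ sAR] := acts.
  rewrite inE fmodP gacentE ?(subset_trans actQ) //; last first.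
    by apply/subsetP=> q; apply: astabs_dom.
  rewrite inE (subsetP sAR) ?fmodP //=; apply/afixP=> q Qq.
  by rewrite -opE // fixv.
exists (fmod abA b); apply: fmod_inj; rewrite Dv fmval_sum.
by apply: eq_bigr => q Qq; rewrite opE // fmodK.
Qed.

Local Notation isoA := (isog_fmod abA).

Lemma card_frattini_center : #|[set: V]| = #|'Z('Phi(G))|.
Proof. exact/esym/card_isog/isoA. Qed.

Lemma NS_not_abelian : ~~ abelian G. Proof. by case: nsG. Qed.

Let V1 : [set: V]%G :!=: 1%g.
Proof.
rewrite -(isog_eq1 isoA); apply: contra NS_not_abelian => /eqP Z1.
have P1 := trivg_center_pgroup (pgroupS (Phi_sub G) NS_pgroup) Z1.
by apply: (@abelem_abelian _ p); rewrite -(trivg_Phi NS_pgroup) P1.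
Qed.

Lemma frattini_quotient_ge : (p ^ 2 <= #|Q|)%N.
Proof.
have pQ : p.-group Q := abelem_pgroup abelQ.
rewrite leqNgt (card_pgroup pQ) ltn_exp2l ?prime_gt1 //.
apply: contra NS_not_abelian => lt2; apply/cyclic_abelian/Phi_quotient_cyclic.
have := card_pgroup pQ; case: (logn _ _) lt2 => [|[|//]] _ oQ.
  by apply: cyclic_small; rewrite oQ.
by apply: prime_cyclic; rewrite oQ.
Qed.

(** A central element outside Phi would act trivially on A, against the
    faithfulness of Q. *)
Lemma center_sub_frattini : 'Z(G) \subset 'Phi(G).
Proof.
apply/subsetP=> z /setIP[Gz cGz]; apply/idPn=> Pz.
have Nz := subsetP nPG z Gz.
have Qz : coset 'Phi(G) z \in Q by rewrite mem_quotient.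
have z1 : coset 'Phi(G) z != 1%g by apply: contra Pz => /eqP/coset_idr->.
have [u /eqP[]] :=
  op_faithful p_pr pV abelQ op1 opM NS_fixed_are_traces Qz z1 V1.
rewrite coset_opE //; apply: fmod_inj; rewrite fmval_conjop ?(subsetP nAN) //.
apply/conjg_fixP/commgP/commute_sym/(centP cGz).
by apply: subsetP (fmodP u); rewrite (subset_trans (center_sub _)) ?Phi_sub.
Qed.

Lemma card_center_eq_fixed :
  #|'Z(G)| = #|[set v : V | [forall q in Q, coset_op q v == v]]|.
Proof.
rewrite -(card_imset _ (@fmod_inj _ _ abA)); apply: eq_card => z.
apply/idP/imsetP => [Zz | [v]].
  have [Gz cGz] := setIP Zz; have Pz := subsetP center_sub_frattini z Zz.
  have Az : z \in 'Z('Phi(G)).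
    by apply/setIP; split=> //; apply: subsetP (centS (Phi_sub G)) z cGz.
  exists (fmod abA z); last by rewrite [RHS]fmodK.
  rewrite inE; apply/'forall_in_eqP=> _ /morphimP[g Ng Gg ->].
  rewrite coset_opE //; apply: fmod_inj; rewrite fmval_conjop ?(subsetP nAN) //.
  rewrite [fmval _]fmodK //; apply/conjg_fixP/commgP.
  exact: (centP cGz).
rewrite inE => /'forall_in_eqP fixv ->.
have Gv : fmval v \in G.
  by apply: subsetP (fmodP v); rewrite (subset_trans (center_sub _)) ?Phi_sub.
apply/setIP; split=> //; apply/centP=> g Gg.
have Ng := subsetP nPG g Gg.
apply/commgP/conjg_fixP; rewrite -fmval_conjop ?(subsetP nAN) // -coset_opE //.
by rewrite fixv // mem_quotient.
Qed.

Lemma gen_of_cosets x y : x \in G -> y \in G ->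
  ([1 coset_of 'Phi(G)]%G <*> <[coset 'Phi(G) x]> <*> <[coset 'Phi(G) y]>)%G
    = Q ->
  <<[set x; y]>> = G.
Proof.
move=> Gx Gy DQ; apply: Phi_nongen.
apply/eqP; rewrite eqEsubset join_subG Phi_sub.
rewrite subUset !sub1set Gx Gy /= -(quotientSGK nPG) ?joing_subl //.
have := congr1 (@gval _) DQ; rewrite /= => <-.
rewrite !join_subG sub1G !cycle_subG !mem_quotient //;
  by rewrite (subsetP (joing_subr _ _)) // !inE eqxx ?orbT.
Qed.

Lemma lift_coset q : q \in Q -> exists2 x, x \in G & q = coset 'Phi(G) x.
Proof. by case/morphimP=> x _ Gx ->; exists x. Qed.

Lemma rank2_generators : #|Q| = (p ^ 2)%N -> exists x y,
  [/\ x \in G, y \in G, coset 'Phi(G) x != 1%g &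
    ([1 coset_of 'Phi(G)]%G <*> <[coset 'Phi(G) x]> <*> <[coset 'Phi(G) y]>)%G
      = Q].
Proof.
move=> oQ.
have [q [r [Qq q1 Qr _ DQ]]] := exists_generators2 p_pr abelQ oQ.
have [x Gx Dq] := lift_coset Qq; have [y Gy Dr] := lift_coset Qr.
by exists x, y; rewrite -Dq -Dr.
Qed.

Lemma NS_grank : #|Q| = (p ^ 2)%N -> 'm(G) = 2.
Proof.
case/rank2_generators=> x [y [Gx Gy _ /(gen_of_cosets Gx Gy) defG]].
apply/eqP; rewrite eqn_leq.
rewrite -{1}defG (leq_trans (grank_min _)) ?cards2; last by case: (x != y).
rewrite ltnNge; apply: contra NS_not_abelian.
have [B <- <-] := grank_witness G; rewrite abelian_gen => leB1.
by apply/centsP=> a Ba b Bb; rewrite (card_le1_eqP leB1 a b Ba Bb).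
Qed.

(** If Phi is abelian, it equals A.  With [trace_kernel] for x, the generators x
    and y can be multiplied by elements of Phi to become commuting elements z
    and t, which still generate G. *)
Lemma frattini_not_abelian : #|Q| = (p ^ 2)%N -> ~~ abelian 'Phi(G).
Proof.
case/rank2_generators=> x [y [Gx Gy x1 DQ]]; apply/negP=> abP.
have DA : 'Z('Phi(G)) = 'Phi(G) by apply/center_idP.
have Nx := subsetP nAN _ (subsetP nPG x Gx).
have Ny := subsetP nAN _ (subsetP nPG y Gy).
have Qx : coset 'Phi(G) x \in Q by rewrite mem_quotient.
set qx := coset _ x in x1 Qx.
have qxp : iter p (coset_op qx) =1 id := op_iter_p p_pr abelQ op1 opM Qx.
have fixV :=
  cyclic_fixed_are_traces p_pr pV abelQ op1 opM NS_fixed_are_traces Qx x1.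
have opx u : coset_op qx u = conjop x u by rewrite coset_opE ?(subsetP nPG).
have trx u : optrace p (coset_op qx) u = optrace p (conjop x) u.
  by apply: eq_bigr => i _; apply: eq_iter.
have Pxp : x ^+ p \in 'Z('Phi(G)).
  rewrite DA; apply: coset_idr; rewrite ?groupX ?(subsetP nPG) //.
  have [_ expQ] := abelemP p_pr abelQ.
  by rewrite morphX ?(subsetP nPG) // expQ.
have [w _ Dw] : exists2 w, w \in [set: V]%G &
    fmod abA (x ^+ p) = optrace p (coset_op qx) w.
  apply: fixV; rewrite ?inE // opx; apply: fmod_inj; rewrite fmval_conjop //.
  by rewrite [fmval _]fmodK // conjXg conjgE mulKg.
(* The factor - w cancels x ^ p, which is the trace of w. *)
pose z := x * fmval (- w)%R.
have zp : z ^+ p = 1.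
  rewrite expg_mul_fmod // -trx (raddfN (optrace p (coset_op qx))) /= -Dw.
  rewrite -[RHS](mulgV (x ^+ p)).
  by congr (_ * _); rewrite -[in RHS](fmodK abA Pxp).
have Nz : z \in 'N('Z('Phi(G))).
  by rewrite groupM // (subsetP (normG _)) // fmodP.
have zx (u : V) : conjop z u = conjop x u.
  apply: fmod_inj; rewrite !fmval_conjop // /z conjgM; apply/conjg_fixP/commgP.
  by apply: (centsP abA); rewrite ?memJ_norm ?fmodP.
have AG (u : V) : fmval u \in G.
  by apply: subsetP (fmodP u); rewrite (subset_trans (center_sub _)) ?Phi_sub.
have Gz : z \in G by rewrite groupM.
have Pzy : [~ z, y] \in 'Z('Phi(G)).
  by rewrite DA (Phi_joing NS_pgroup) (subsetP (joing_subl _ _)) ?mem_commg.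
(* Since z and z ^ y both have trivial p-th power, their quotient [~ z, y] has
   trace zero. *)
have [b _ Db] : exists2 b, b \in [set: V]%G &
    fmod abA [~ z, y] = opdiff (coset_op qx) b.
  apply: (trace_kernel p_pr qxp) => // [u _||]; rewrite ?in_setT //.
  apply: etrans (trx _) _; apply: fmod_inj.
  have : (z * fmval (fmod abA [~ z, y])) ^+ p = 1.
    by rewrite [fmval _]fmodK // -conjg_mulR -conjXg zp conj1g.
  rewrite expg_mul_fmod // zp mul1g => trz1; apply: etrans trz1; congr fmval.
  by apply: eq_bigr => i _; apply: eq_iter => u; exact: esym (zx u).
(* Conjugation by b multiplies z by the inverse of the difference of b, which
   cancels [~ z, y]. *)
pose t := y * fmval b.
have zt : commute z t.
  apply/commgP/conjg_fixP; rewrite /t conjgM (conjg_mulR z y) conjMg.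
  have -> : [~ z, y] ^ fmval b = [~ z, y].
    apply/conjg_fixP/commgP/(centsP abA) => //; exact: fmodP.
  have -> : z ^ fmval b = z * fmval (- opdiff (coset_op qx) b)%R.
    rewrite /opdiff opprB opx -zx.
    transitivity (z * (fmval b * (fmval b ^ z)^-1)); last by rewrite -fmval_conjop.
    rewrite (centsP abA _ (fmodP b)) ?groupV ?memJ_norm ?fmodP //.
    by rewrite -conjVg !conjgE !mulgA mulgV mul1g.
  rewrite -[X in _ * X = _](fmodK abA Pzy) [X in _ * val X]Db -mulgA.
  by rewrite -[RHS]mulg1; congr (_ * _); apply: mulVg.
case/negP: NS_not_abelian.
have <- : <<[set z; t]>> = G.
  have coset_mul g (u : V) : g \in G -> coset 'Phi(G) (g * fmval u) = coset 'Phi(G) g.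
    move=> Gg; have Pu := subsetP (center_sub 'Phi(G)) _ (fmodP u).
    by rewrite morphM ?(subsetP nPG) //= (coset_id Pu) mulg1.
  apply: gen_of_cosets; rewrite ?groupM // !coset_mul //.
by rewrite abelian_gen; apply/centsP=> a /set2P[]-> c /set2P[]-> //.
Qed.

Lemma frattini_center_index_ge : #|Q| = (p ^ 2)%N ->
  (p ^ 2 <= #|'Phi(G) : 'Z('Phi(G))|)%N.
Proof.
move=> oQ; have pP := pgroupS (Phi_sub G) NS_pgroup.
have pPZ : p.-group ('Phi(G) / 'Z('Phi(G))) := quotient_pgroup _ pP.
rewrite -card_quotient ?normal_norm ?center_normal //.
rewrite leqNgt (card_pgroup pPZ) ltn_exp2l ?prime_gt1 //.
apply: contra (frattini_not_abelian oQ) => lt2.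
apply: cyclic_center_factor_abelian.
have := card_pgroup pPZ; case: (logn _ _) lt2 => [|[|//]] _ oPZ.
  by apply: cyclic_small; rewrite oPZ.
by apply: prime_cyclic; rewrite oPZ.
Qed.

Lemma card_frattini_product :
  #|G| = (#|Q| * (#|'Phi(G) : 'Z('Phi(G))| * #|'Z('Phi(G))|))%N.
Proof.
rewrite [X in (_ * X)%N]mulnC Lagrange ?center_sub //.
by rewrite card_quotient // mulnC Lagrange ?Phi_sub.
Qed.

Lemma card_frattini_center_ge : (p ^ (p + 2) <= #|'Z('Phi(G))|)%N.
Proof.
rewrite -card_frattini_center cardsT.
exact: card_ge_of_rank2 NS_fixed_are_traces V1 frattini_quotient_ge.
Qed.

(** If the rank of Q is at least 3, the bound p ^ (p + 4) on A already makes G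
    too large. *)
Lemma frattini_quotient_eq : (#|G| <= p ^ (p + 6))%N -> #|Q| = (p ^ 2)%N.
Proof.
move=> leG; have pQ : p.-group Q := abelem_pgroup abelQ.
apply/eqP; rewrite eqn_leq frattini_quotient_ge andbT leqNgt; apply/negP.
rewrite {1}(card_pgroup pQ) ltn_exp2l ?prime_gt1 // => rk3.
have geQ : (p ^ 3 <= #|Q|)%N by rewrite (card_pgroup pQ) leq_exp2l ?prime_gt1.
have := card_ge_of_rank3 p_pr pV abelQ op1 opM NS_fixed_are_traces V1 geQ.
rewrite -cardsT card_frattini_center => geA.
have : (p ^ (p + 7) <= #|G|)%N.
  rewrite card_frattini_product (_ : p + 7 = 3 + (p + 4))%N; last by lia.
  rewrite expnD leq_mul // (leq_trans geA) // leq_pmull //.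
move/leq_trans/(_ leG); rewrite leq_exp2l ?prime_gt1 // leq_add2l.
by [].
Qed.

Lemma NS_card_ge : (p ^ (p + 6) <= #|G|)%N.
Proof.
have [leG|/ltnW//] := leqP #|G| (p ^ (p + 6)).
have oQ := frattini_quotient_eq leG.
rewrite card_frattini_product oQ (_ : p + 6 = 2 + (2 + (p + 2)))%N; last by lia.
rewrite 2!expnD leq_mul // leq_mul //; last exact: card_frattini_center_ge.
exact: frattini_center_index_ge.
Qed.

Lemma frattini_center_eq : #|G| = (p ^ (p + 6))%N ->
  #|'Z('Phi(G))| = (p ^ (p + 2))%N.
Proof.
move=> oG; have oQ : #|Q| = (p ^ 2)%N by rewrite frattini_quotient_eq ?oG.
apply/eqP; rewrite eqn_leq card_frattini_center_ge andbT.
have p0 : (0 < p ^ 2)%N by rewrite expn_gt0 prime_gt0.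
rewrite -(leq_pmul2l p0) -(leq_pmul2l p0) -!expnD.
rewrite (_ : 2 + (2 + (p + 2)) = p + 6)%N; last by lia.
rewrite -oG card_frattini_product oQ leq_mul2l leq_mul2r frattini_center_index_ge //.
by rewrite !orbT.
Qed.

Lemma NS_card_center : #|G| = (p ^ (p + 6))%N -> #|'Z(G)| = p.
Proof.
move=> oG; have oQ : #|Q| = (p ^ 2)%N by rewrite frattini_quotient_eq ?oG.
rewrite card_center_eq_fixed; apply: card_fixed => //.
  exact: NS_fixed_are_traces.
by rewrite -cardsT card_frattini_center frattini_center_eq.
Qed.

Lemma frattini_center_type : p = 2 -> #|G| = (p ^ (p + 6))%N ->
  'Z('Phi(G)) \isog [set: 'Z_2 * 'Z_2 * 'Z_2 * 'Z_2] \/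
  'Z('Phi(G)) \isog [set: 'Z_4 * 'Z_2 * 'Z_2].
Proof.
move=> p2 oG; have oA : #|'Z('Phi(G))| = 16 by rewrite frattini_center_eq // p2.
have le8 : (8 <= #|[set v in [set: V] | (v * v == 1)%g]|)%N.
  have := card_double0 p_pr pV abelQ op1 opM NS_fixed_are_traces p2.
  rewrite -cardsT card_frattini_center => /(_ _ oA) le8.
  apply: leq_trans (le8 _) _.
    by have := frattini_quotient_ge; rewrite p2.
  by apply/subset_leq_card/subsetP=> v; rewrite !inE.
have oV : #|[set: V]| = 16 by rewrite card_frattini_center.
have [iso|iso] := abelian16_isog (zmod_abelian _) oV le8; [left|right];
  exact: isog_trans isoA iso.
Qed.

End FrattiniCenter.

Theorem mainTheorem1 (gT : finGroupType) (p : nat) (G : {group gT}) :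
  prime p -> NS_group p G ->
  (p ^ (p + 6) <= #|G|)%N /\
  (#|G| = (p ^ (p + 6))%N ->
   [/\ 'm(G) = 2,
       #|'Z('Phi(G))| = (p ^ (p + 2))%N,
       cyclic 'Z(G) /\ #|'Z(G)| = p
     & p = 2 ->
       'Z('Phi(G)) \isog [set: 'Z_2 * 'Z_2 * 'Z_2 * 'Z_2] \/
       'Z('Phi(G)) \isog [set: 'Z_4 * 'Z_2 * 'Z_2]]).
Proof.
move=> p_pr nsG; split=> [|oG]; first exact: NS_card_ge p_pr nsG.
have oZ := NS_card_center p_pr nsG oG.
split.
- by apply: (NS_grank p_pr nsG); rewrite (frattini_quotient_eq p_pr nsG) ?oG.
- exact: frattini_center_eq.
- by split=> //; apply: prime_cyclic; rewrite oZ.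
by move=> p2; apply: frattini_center_type p_pr nsG p2 oG.
Qed.
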